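(* Let $C \in \mathbb{R}^{n\times n}$ with $C = C^\top \neq 0$, let $$F := \begin{bmatrix} 0 & 1 \\ -1 & 0 \end{bmatrix} \otimes C = \begin{bmatrix} 0 & C \\ -C & 0 \end{bmatrix} \in \mathbb{R}^{2n \times 2n},$$ and let $(\alpha_k)_{k\in\mathbb{N}}$ be a real sequence such that $0 < \alpha_k \le \alpha^{\max} < \infty$ for all $k \in \mathbb{N}$, for some $\alpha^{\max}$, with $\lim_{k\to\infty}\alpha_k = 0$ and $\sum_{k=0}^\infty \alpha_k = \infty$. Then the system $$\boldsymbol{x}(k+1) = \boldsymbol{x}(k) - \alpha_k F\, \boldsymbol{x}(k), \quad k \in \mathbb{N},$$ does not globally converge, i.e., it is not the case that for every $\boldsymbol{x}(0) \in \mathbb{R}^{2n}$ the solution $\boldsymbol{x}(k)$ converges to some vector in $\mathbb{R}^{2n}$.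
   Context: The symbol $\otimes$ denotes the Kronecker product. The matrix $F$ is the pseudo-gradient mapping $\boldsymbol{x}=(x_1,x_2) \mapsto (\nabla_{x_1} f_1(x_1,x_2), \nabla_{x_2} f_2(x_1,x_2)) = (C x_2, -C x_1)$ of the two-player zero-sum game with cost functions $f_1(x_1,x_2) = x_1^\top C x_2$ and $f_2(x_1,x_2) = -x_2^\top C^\top x_1$, $x_1,x_2 \in \mathbb{R}^n$. A system globally converges if for all initial conditions its solution converges to some vector (possibly depending on the initial condition). *)

(* Defs.v *)
From HB Require Import structures.
From mathcomp Require Import all_boot all_order all_algebra.
From mathcomp Require Import all_classical all_reals all_analysis.
From mathcomp Require Import mxtens.

Set Implicit Arguments.
Unset Strict Implicit.
Unset Printing Implicit Defensive.

Import Order.TTheory GRing.Theory Num.Theory.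
Import numFieldNormedType.Exports.

Local Open Scope classical_set_scope.
Local Open Scope ring_scope.

Definition skew2 {R : realType} : 'M[R]_2 :=
  block_mx (0 : 'M[R]_1) 1 (- 1) 0.

(** [*t] is the Kronecker product. *)
Definition pseudo_gradient_mx {R : realType} {n : nat} (C : 'M[R]_n)
    : 'M[R]_(2 * n) :=
  skew2 *t C.

(** The cast identifies the index type ['I_(2 * n)] with ['I_(n + n)]. *)
Lemma pseudo_gradient_mxE {R : realType} {n : nat} (C : 'M[R]_n)
    (e : (2 * n = n + n)%N) :
  castmx (e, e) (pseudo_gradient_mx C) = block_mx 0 C (- C) 0.
Proof.
have lE k : cast_ord (esym e) (lshift n k)
    = mxtens_index (@lshift 1 1 ord0 : 'I_2, k) by exact: val_inj.
have rE k : cast_ord (esym e) (rshift n k)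
    = mxtens_index (@rshift 1 1 ord0 : 'I_2, k).
  by apply: val_inj; rewrite /= mul1n.
apply/matrixP => i j; rewrite castmxE /pseudo_gradient_mx.
case: (split_ordP i) => a ->; case: (split_ordP j) => b ->;
  rewrite ?lE ?rE tensmxE /skew2.
- by rewrite (@block_mxEul _ 1 1 1 1) block_mxEul !mxE mul0r.
- by rewrite (@block_mxEur _ 1 1 1 1) block_mxEur !mxE mul1r.
- by rewrite (@block_mxEdl _ 1 1 1 1) block_mxEdl !mxE mulN1r.
- by rewrite (@block_mxEdr _ 1 1 1 1) block_mxEdr !mxE mul0r.
Qed.

(** Solution of the time-varying system [x (k + 1) = g k (x k)], [x 0 = x0];
    [iteri k g x0] is [g (k - 1) (... (g 0 x0))]. *)
Definition solution {R : realType} {m : nat} (g : nat -> 'cV[R]_m -> 'cV[R]_m)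
    (x0 : 'cV[R]_m) : nat -> 'cV[R]_m :=
  fun k => iteri k g x0.

Definition globally_converges {R : realType} {m : nat}
    (g : nat -> 'cV[R]_m -> 'cV[R]_m) : Prop :=
  forall x0 : 'cV[R]_m, exists xbar : 'cV[R]_m,
    solution g x0 k @[k --> \oo] --> xbar.

(* Main.v *)
(** [F] is skew-symmetric because [C] is symmetric.  Along a solution [x], the
    sequence [F x(k)] solves the same recursion, and a skew step
    [y - alpha F y] never decreases the Euclidean norm.  So if [F x(0) <> 0]
    and [x(k)] tended to [l], then [F l <> 0].  But then [<F l, x(k)>] would
    decrease by [alpha_k <F l, F x(k)>], where [<F l, F x(k)>] tends to
    [|F l|^2 > 0], and since the [alpha_k] have infinite sum it could not
    converge. *)
Require Import Defs.
From HB Require Import structures.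
From mathcomp Require Import all_boot all_order all_algebra.
From mathcomp Require Import all_classical all_reals all_analysis.
From mathcomp Require Import mxtens ring lra.
Import Order.TTheory GRing.Theory Num.Theory.
Import numFieldNormedType.Exports.
Local Open Scope classical_set_scope.
Local Open Scope ring_scope.

Section Dot.
Context {R : realType} {m : nat}.
Implicit Types (u v w : 'cV[R]_m) (F : 'M[R]_m).

Definition dot u v : R := \sum_i u i 0 * v i 0.

Lemma dotC u v : dot u v = dot v u.
Proof. by apply: eq_bigr => i _; rewrite mulrC. Qed.

Lemma dotBr u v w : dot u (v - w) = dot u v - dot u w.
Proof. by rewrite -sumrB; apply: eq_bigr => i _; rewrite !mxE mulrBr. Qed.

Lemma dotZr (a : R) u v : dot u (a *: v) = a * dot u v.
Proof. by rewrite mulr_sumr; apply: eq_bigr => i _; rewrite !mxE mulrCA. Qed.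

Lemma dot_ge0 u : 0 <= dot u u.
Proof. by apply: sumr_ge0 => i _; rewrite -expr2 sqr_ge0. Qed.

Lemma dot_gt0 u : u != 0 -> 0 < dot u u.
Proof.
move=> u0; rewrite lt_def dot_ge0 andbT; apply: contra_neq u0 => /eqP.
rewrite psumr_eq0; last by move=> i _; rewrite -expr2 sqr_ge0.
move=> /allP u0; apply/matrixP => i j; rewrite ord1 mxE; apply/eqP.
by move: (u0 i (mem_index_enum i)); rewrite -expr2 sqrf_eq0.
Qed.

Lemma dot_mulmx F u v : dot u (F *m v) = dot (F^T *m u) v.
Proof.
transitivity (\sum_i \sum_j u i 0 * F i j * v j 0).
  apply: eq_bigr => i _; rewrite mxE mulr_sumr.
  by apply: eq_bigr => j _; rewrite mulrA.
rewrite exchange_big; apply: eq_bigr => j _; rewrite mxE mulr_suml.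
by apply: eq_bigr => i _; rewrite mxE (mulrC (F i j)).
Qed.

(** Moving [F] across the product turns [dot u (F *m u)] into its own negative. *)
Lemma dot_mulmx_skew F u : F^T = - F -> dot u (F *m u) = 0.
Proof.
move=> FN; have := dot_mulmx F u u; rewrite FN mulNmx (dotC (- _)).
by rewrite -[- (F *m u)]scaleN1r dotZr; lra.
Qed.

(** Entrywise hypotheses reduce the limit to finite sums of products of real sequences. *)
Lemma dot_cvg (x y : nat -> 'cV[R]_m) u v :
  (forall i, x k i 0 @[k --> \oo] --> u i 0) ->
  (forall i, y k i 0 @[k --> \oo] --> v i 0) ->
  dot (x k) (y k) @[k --> \oo] --> dot u v.
Proof.
by move=> xu yv; apply: cvg_big => [|i _]; [exact: add_continuous|exact: cvgM].
Qed.

Lemma mulmx_cvg F (x : nat -> 'cV[R]_m) u :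
  (forall i, x k i 0 @[k --> \oo] --> u i 0) ->
  forall i, (F *m x k) i 0 @[k --> \oo] --> (F *m u) i 0.
Proof.
move=> xu i; rewrite mxE; under eq_fun do rewrite mxE.
apply: cvg_big => [|j _]; first exact: add_continuous.
by apply: cvgM; first exact: cvg_cst.
Qed.

End Dot.

(** Once [t k] is at least [d / 2], each step lowers [s] by at least [d / 2 * alpha k]. A convergent
    [s] can only drop by a bounded amount, which bounds the partial sums of [alpha]. *)
Lemma series_not_pinfty_of_decrease {R : realType} (alpha s t : nat -> R)
    (d l : R) :
  (forall k, 0 <= alpha k) -> 0 < d ->
  (forall k, s k.+1 = s k - alpha k * t k) ->
  t k @[k --> \oo] --> d -> s k @[k --> \oo] --> l ->
  ~ (\sum_(0 <= i < k) alpha i @[k --> \oo] --> +oo).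
Proof.
move=> a0 d0 sS td sl aoo.
have [K _ tK] : \forall k \near \oo, d / 2 <= t k.
  by apply: (cvgr_ge _ td); lra.
pose S k : R := \sum_(0 <= i < k) alpha i.
have bound k : d / 2 * (S (K + k)%N - S K) <= s K - s (K + k)%N.
  elim: k => [|k IH]; first by rewrite addn0 !subrr mulr0.
  have := ler_wpM2l (a0 (K + k)%N) (tK _ (leq_addr k K)).
  rewrite addnS sS /S big_nat_recr //= -/(S (K + k)%N) -/(S K) => h; lra.
have [k1 _ sk1] : \forall k \near \oo, l - 1 <= s k.
  by apply: (cvgr_ge _ sl); lra.
(* The threshold is chosen so that [bound] forces a drop of at least [s K - l + 2], that is
   [s (K + k) <= l - 2], against [l - 1 <= s (K + k)]. *)
have [k2 _ Sk2] :
    \forall k \near \oo, S K + 2 / d * (s K - l + 2) <= S k.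
  by move/cvgryPge : aoo; apply.
pose k := (k1 + k2)%N.
have lek1 : (k1 <= K + k)%N by rewrite addnCA leq_addr.
have lek2 : (k2 <= K + k)%N by rewrite addnA leq_addl.
have := ler_wpM2l (ltW (divr_gt0 d0 (ltr0n _ 2))) (Sk2 _ lek2).
have -> : d / 2 * (S K + 2 / d * (s K - l + 2)) = d / 2 * S K + (s K - l + 2).
  by field; rewrite gt_eqF.
by have := bound k; have := sk1 _ lek1; rewrite /=; lra.
Qed.

Lemma skew_gradient_step_diverges {R : realType} {m : nat} (F : 'M[R]_m)
    (alpha : nat -> R) :
  F^T = - F -> F != 0 -> (forall k, 0 <= alpha k) ->
  \sum_(0 <= i < k) alpha i @[k --> \oo] --> +oo ->
  ~ globally_converges (fun k x => x - alpha k *: (F *m x)).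
Proof.
move=> FN F0 a0 aoo gc.
(* A nonzero entry in column [j] makes the image of the [j]-th basis vector nonzero. *)
have [x0 Fx0] : exists x0 : 'cV[R]_m, F *m x0 != 0.
  case/matrix0Pn: F0 => i [j Fij]; exists (delta_mx j 0).
  by rewrite -colE; apply/matrix0Pn; exists i, 0; rewrite mxE.
have [l xl] := gc x0.
set x := solution _ x0 in xl.
have xS k : x k.+1 = x k - alpha k *: (F *m x k) by [].
have Fx_ge k : dot (F *m x0) (F *m x0) <= dot (F *m x k) (F *m x k).
  elim: k => // k /le_trans; apply.
  (* The new vector is [y - alpha k *: z] with [z] orthogonal to [y], so by Pythagoras the squared
     norm grows by [alpha k ^ 2] times that of [z]. *)
  rewrite xS mulmxBr -scalemxAr; set y := F *m x k; set z := F *m y.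
  have yz : dot y z = 0 by exact: dot_mulmx_skew.
  rewrite dotBr dotZr 2!(dotC (y - _)) !dotBr !dotZr (dotC z y) yz.
  by rewrite mulr0 subr0 sub0r mulrN opprK lerDl !mulr_ge0 ?dot_ge0.
have xl_ i : x k i 0 @[k --> \oo] --> l i 0.
  by apply: (cvg_comp x (fun M : 'cV[R]_m => M i 0) xl); exact: coord_continuous.
have Fxl := mulmx_cvg F _ _ xl_.
(* The lower bound [Fx_ge] is uniform in [k], hence survives in the limit. *)
have Fl_gt0 : 0 < dot (F *m l) (F *m l).
  apply: lt_le_trans (dot_gt0 _ Fx0) _.
  by apply: (cvgr_to_ge (dot_cvg _ _ _ _ Fxl Fxl)); exact: nearW.
apply: (series_not_pinfty_of_decrease alpha (fun k => dot (F *m l) (x k))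
  (fun k => dot (F *m l) (F *m x k)) _ _ a0 Fl_gt0 _ _ _ aoo).
- by move=> k; rewrite xS dotBr dotZr.
- by apply: dot_cvg => // i; exact: cvg_cst.
- by apply: dot_cvg => // i; exact: cvg_cst.
Qed.

Lemma skew2_tr {R : realType} : (skew2 : 'M[R]_2)^T = - skew2.
Proof.
rewrite /skew2 (@tr_block_mx _ 1 1 1 1) (@opp_block_mx _ 1 1 1 1).
by rewrite linearN /= !trmx0 !trmx1 oppr0 opprK.
Qed.

Lemma tensNmx {R : comPzRingType} {m n p q : nat} (A : 'M[R]_(m, n))
    (B : 'M[R]_(p, q)) : (- A) *t B = - (A *t B).
Proof. by apply/matrixP => i j; rewrite !mxE mulNr. Qed.

Theorem corollary2 (R : realType) (n : nat) (C : 'M[R]_n)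
    (C_sym : C = C^T) (C_neq0 : C <> 0)
    (alpha : nat -> R) (alpha_max : R)
    (alpha_bounds : forall k : nat, 0 < alpha k <= alpha_max)
    (alpha_lim : alpha k @[k --> \oo] --> (0 : R))
    (alpha_sum : \sum_(0 <= i < k) alpha i @[k --> \oo] --> +oo) :
  ~ globally_converges
      (fun (k : nat) (x : 'cV[R]_(2 * n)) =>
         x - alpha k *: (pseudo_gradient_mx C *m x)).
Proof.
apply: skew_gradient_step_diverges => //.
(* Transposition acts on each Kronecker factor; [C] is fixed and [skew2] supplies the sign. *)
- by rewrite /pseudo_gradient_mx trmx_tens -C_sym skew2_tr tensNmx.
- apply/eqP => F0; apply: C_neq0; apply/matrixP => i j; rewrite mxE.
  (* The upper right entry of [skew2] is 1, so that block of the product is a copy of [C]. *)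
  have /matrixP/(_ (mxtens_index (@lshift 1 1 ord0 : 'I_2, i))
    (mxtens_index (@rshift 1 1 ord0 : 'I_2, j))) := F0.
  by rewrite tensmxE (@block_mxEur _ 1 1 1 1) !mxE mul1r.
- by move=> k; case/andP: (alpha_bounds k) => /ltW.
Qed.
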